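(* Under the assumptions on $f$, $r$, $\lambda$, $\tau$ listed in the context, let $\{\mathbf{X}_t\}$ be the sequence generated by the FaNCL algorithm (described in the context), and let $c_1=\frac{\tau-\rho}{4}$. Then for every $T\ge1$, $$\min_{t=1,\dots,T}\|\mathbf{X}_{t+1}-\mathbf{X}_t\|_F^2\le\frac{F(\mathbf{X}_1)-\inf F}{c_1T}.$$
   Context: Problem: minimize $F(\mathbf{X})=f(\mathbf{X})+\lambda r(\mathbf{X})$ over $\mathbf{X}\in\mathbb{R}^{m\times n}$, $\lambda>0$. Assumptions. (A1) $f:\mathbb{R}^{m\times n}\to\mathbb{R}$ is differentiable (not necessarily convex) with $\rho$-Lipschitz gradient: $\|\nabla f(\mathbf{X}_1)-\nabla f(\mathbf{X}_2)\|_F\le\rho\|\mathbf{X}_1-\mathbf{X}_2\|_F$, $\rho\le1$. (A2) $\inf f>-\infty$ and $f(\mathbf{X})\to\infty$ as $\|\mathbf{X}\|_F\to\infty$. (A3) $r(\mathbf{X})=\sum_i\hat r(\sigma_i(\mathbf{X}))$, where $\sigma_i(\mathbf{X})$ is the $i$-th largest singular value and $\hat r:[0,\infty)\to\mathbb{R}$ is concave and non-decreasing with $\hat r(0)=0$. Fix $\tau>\rho$ and $c_1=\frac{\tau-\rho}{4}$. Threshold: $\gamma>0$ is a number such that $y=0$ minimizes $\frac12(y-\sigma)^2+\mu\hat r(y)$ over $y\ge0$ whenever $0\le\sigma\le\gamma$, where $\mu=\lambda/\tau$. $\mathrm{QR}(\mathbf{A})$ denotes the matrix with orthonormal columns from a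 QR decomposition of $\mathbf{A}$. PowerMethod$(\mathbf{Z},\mathbf{R})$, $\mathbf{Z}\in\mathbb{R}^{m\times n}$, $\mathbf{R}\in\mathbb{R}^{n\times k}$, $J=3$: $\mathbf{Y}_1=\mathbf{Z}\mathbf{R}$; for $j=1,\dots,J$: $\mathbf{Q}_j=\mathrm{QR}(\mathbf{Y}_j)$, $\mathbf{Y}_{j+1}=\mathbf{Z}(\mathbf{Z}^\top\mathbf{Q}_j)$; return $\mathbf{Q}_J$. ApproxGSVT$(\mathbf{Z},\mathbf{R},\mu)$: $\mathbf{Q}=$ PowerMethod$(\mathbf{Z},\mathbf{R})$; compute the SVD $\mathbf{U}\mathbf{\Sigma}\mathbf{V}^\top$ of $\mathbf{Q}^\top\mathbf{Z}$; $a=$ number of $\Sigma_{ii}>\gamma$; $\mathbf{U}_a,\mathbf{V}_a=$ the $a$ leading columns of $\mathbf{U},\mathbf{V}$; $y_i^*\in\operatorname{Arg\,min}_{y\ge0}\frac12(y-\Sigma_{ii})^2+\mu\hat r(y)$ for $i\le a$; return $\tilde{\mathbf{X}}=\mathbf{Q}\mathbf{U}_a\operatorname{Diag}(y_1^*,\dots,y_a^* )\mathbf{V}_a^\top$ and $\mathbf{V}$. InexactPS$(\mathbf{X},\mathbf{R})$: $\mathbf{X}_{\rm gd}=\mathbf{X}-\frac1\tau\nabla f(\mathbf{X})$; $\tilde{\mathbf{V}}_0=\mathbf{R}$; for $p=1,2,\dots$: $[\tilde{\mathbf{X}}_p,\tilde{\mathbf{V}}_p]=$ ApproxGSVT$(\mathbf{X}_{\rm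 gd},\tilde{\mathbf{V}}_{p-1},\lambda/\tau)$, stopping as soon as $F(\tilde{\mathbf{X}}_p)\le F(\mathbf{X})-c_1\|\tilde{\mathbf{X}}_p-\mathbf{X}\|_F^2$; return $\tilde{\mathbf{X}}_p,\tilde{\mathbf{V}}_p$. FaNCL: $\mathbf{V}_0,\mathbf{V}_1\in\mathbb{R}^{n\times1}$ random Gaussian, $\mathbf{X}_1=0$; for $t=1,2,\dots$: $\mathbf{R}_t=\mathrm{QR}([\mathbf{V}_t,\mathbf{V}_{t-1}])$, $[\mathbf{X}_{t+1},\mathbf{V}_{t+1}]=$ InexactPS$(\mathbf{X}_t,\mathbf{R}_t)$. The sequence $\{\mathbf{X}_t\}$ being generated means that every call to InexactPS terminates. *)

(* Defs.v *)
From HB Require Import structures.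
From mathcomp Require Export all_boot all_order all_algebra.
From mathcomp Require Import polyrcf.
From mathcomp Require Export all_classical all_reals all_analysis.
Set Implicit Arguments.
Unset Strict Implicit.
Unset Printing Implicit Defensive.

Export Order.TTheory GRing.Theory Num.Theory.
Export numFieldNormedType.Exports.
Global Open Scope classical_set_scope.
Global Open Scope ring_scope.

(* The library norm on matrices is the entrywise sup norm. *)
Definition fnorm (R : realType) (m n : nat) (A : 'M[R]_(m, n)) : R :=
  Num.sqrt (\sum_i \sum_j A i j ^+ 2).

(* Differentiability does not depend on the norm; this is the gradient for the
   inner product tr(A^T B), whose norm is fnorm. *)
Definition grad (R : realType) (m n : nat) (f : 'M[R]_(m, n) -> R)
    (X : 'M[R]_(m, n)) : 'M[R]_(m, n) :=
  \matrix_(i, j) 'D_(delta_mx i j) (f : 'M[R]_(m, n) -> R^o) X.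

(* Square roots of the n eigenvalues of X^T X, listed with multiplicity in
   non-increasing order (rootsR enumerates distinct roots increasingly). *)
Definition singular_values (R : realType) (m n : nat) (X : 'M[R]_(m, n)) :
    seq R :=
  let p := char_poly (X^T *m X) in
  rev (flatten [seq nseq (mup x p) (Num.sqrt x) | x <- rootsR p]).

(* 0-based: sing_val X 0 is the largest singular value. *)
Definition sing_val (R : realType) (m n : nat) (X : 'M[R]_(m, n)) (i : nat) :
    R :=
  (singular_values X)`_i.

Definition regularizer (R : realType) (m n : nat) (rhat : R -> R)
    (X : 'M[R]_(m, n)) : R :=
  \sum_(i < minn m n) rhat (sing_val X i).

Definition objective (R : realType) (m n : nat) (f : 'M[R]_(m, n) -> R)
    (rhat : R -> R) (lambda : R) (X : 'M[R]_(m, n)) : R :=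
  f X + lambda * regularizer rhat X.

Definition prox_argmin (R : realType) (rhat : R -> R) (mu s y : R) : Prop :=
  0 <= y /\
  forall z, 0 <= z ->
    2^-1 * (y - s) ^+ 2 + mu * rhat y <= 2^-1 * (z - s) ^+ 2 + mu * rhat z.

(* Reduced ("thin") QR: A = Q T with T upper triangular. QR is a relation, since
   a decomposition need not be unique (e.g. when A is rank deficient). The
   number q of columns of Q is a free index pinned by an equation, to avoid
   casts. *)
Definition is_qr (R : realType) (m k q : nat) (A : 'M[R]_(m, k))
    (Q : 'M[R]_(m, q)) : Prop :=
  [/\ q = minn m k,
      Q^T *m Q = 1%:M
    & exists2 T : 'M[R]_(q, k), is_trig_mx T^T & A = Q *m T].

(* Reduced SVD A = U diag(s) V^T. *)
Definition is_svd (R : realType) (m n l : nat) (A : 'M[R]_(m, n))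
    (U : 'M[R]_(m, l)) (s : 'rV[R]_l) (V : 'M[R]_(n, l)) : Prop :=
  [/\ l = minn m n,
      U^T *m U = 1%:M,
      V^T *m V = 1%:M,
      (forall i, 0 <= s 0 i) /\ (forall i j : 'I_l, (i <= j)%N -> s 0 j <= s 0 i)
    & A = U *m diag_mx s *m V^T].

(* Q_{j+1} is QR(Z (Z^T Q_j)); all the Q_j share the width of Q_1. *)
Definition power_method (R : realType) (m n k q : nat) (J : nat)
    (Z : 'M[R]_(m, n)) (W : 'M[R]_(n, k)) (Q : 'M[R]_(m, q)) : Prop :=
  exists Qs : nat -> 'M[R]_(m, q),
    [/\ is_qr (Z *m W) (Qs 1%N),
        forall j, (1 <= j < J)%N -> is_qr (Z *m (Z^T *m Qs j)) (Qs j.+1)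
      & Q = Qs J].

Definition num_above (R : realType) (l : nat) (gamma : R) (s : 'rV[R]_l) : nat :=
  #|[set i : 'I_l | gamma < s 0 i]%SET|.

Lemma num_above_le (R : realType) (l : nat) (gamma : R) (s : 'rV[R]_l) :
  (num_above gamma s <= l)%N.
Proof. by rewrite -[leqRHS]card_ord max_card. Qed.

Definition leading_cols (R : realType) (p l a : nat) (le_al : (a <= l)%N)
    (A : 'M[R]_(p, l)) : 'M[R]_(p, a) :=
  colsub (widen_ord le_al) A.

Definition approx_gsvt (R : realType) (m n k l : nat) (rhat : R -> R)
    (gamma mu : R) (Z : 'M[R]_(m, n)) (W : 'M[R]_(n, k))
    (X : 'M[R]_(m, n)) (V : 'M[R]_(n, l)) : Prop :=
  exists (q : nat) (Q : 'M[R]_(m, q)) (U : 'M[R]_(q, l)) (s : 'rV[R]_l),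
    [/\ power_method 3 Z W Q,
        is_svd (Q^T *m Z) U s V
      & let le_al := num_above_le gamma s in
        exists2 y : 'rV[R]_(num_above gamma s),
          forall i, prox_argmin rhat mu (s 0 (widen_ord le_al i)) (y 0 i)
        & X = Q *m leading_cols le_al U *m diag_mx y *m (leading_cols le_al V)^T].

(* The widths of the matrices V vary along the iterations. *)
Definition colmx (R : realType) (n : nat) : Type := {k : nat & 'M[R]_(n, k)}.

Definition to_colmx (R : realType) (n k : nat) (A : 'M[R]_(n, k)) : colmx R n :=
  existT (fun k => 'M[R]_(n, k)) k A.

Definition sufficient_decrease (R : realType) (m n : nat)
    (F : 'M[R]_(m, n) -> R) (c1 : R) (X Xnew : 'M[R]_(m, n)) : bool :=
  F Xnew <= F X - c1 * fnorm (Xnew - X) ^+ 2.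

(* (Xout, Vout) is what a terminating call returns, p being the number of
   inner iterations; Xs 0 is not used. *)
Definition inexact_ps (R : realType) (m n : nat) (f : 'M[R]_(m, n) -> R)
    (rhat : R -> R) (lambda tau gamma c1 : R)
    (X : 'M[R]_(m, n)) (W : colmx R n)
    (Xout : 'M[R]_(m, n)) (Vout : colmx R n) : Prop :=
  let F := objective f rhat lambda in
  let Xgd := X - tau^-1 *: grad f X in
  exists (p : nat) (Xs : nat -> 'M[R]_(m, n)) (Vs : nat -> colmx R n),
    [/\ (1 <= p)%N /\ Vs 0%N = W,
        forall i, (i < p)%N ->
          approx_gsvt rhat gamma (lambda / tau) Xgd
            (projT2 (Vs i)) (Xs i.+1) (projT2 (Vs i.+1)),
        forall i, (1 <= i < p)%N -> ~~ sufficient_decrease F c1 X (Xs i),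
        sufficient_decrease F c1 X (Xs p)
      & Xout = Xs p /\ Vout = Vs p].

(* X and V form a possible run of the algorithm; X 0 is not used. The Gaussian
   draws V_0, V_1 are arbitrary vectors: a run is one realization. *)
Definition fancl (R : realType) (m n : nat) (f : 'M[R]_(m, n) -> R)
    (rhat : R -> R) (lambda tau gamma c1 : R)
    (X : nat -> 'M[R]_(m, n)) (V : nat -> colmx R n) : Prop :=
  [/\ exists V0 : 'cV[R]_n, V 0%N = to_colmx V0,
      exists V1 : 'cV[R]_n, V 1%N = to_colmx V1,
      X 1%N = 0
    & forall t, (1 <= t)%N ->
        exists (q : nat) (W : 'M[R]_(n, q)),
          is_qr (row_mx (projT2 (V t)) (projT2 (V t.-1))) W /\
          inexact_ps f rhat lambda tau gamma c1
            (X t) (to_colmx W) (X t.+1) (V t.+1)].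

(* Main.v *)
Require Import Defs.

(** The stopping test of InexactPS gives F(X_{t+1}) <= F(X_t) - c1 |X_{t+1} - X_t|^2;
    summing over t telescopes, F is bounded below because the regularizer is
    nonnegative, and T times the minimum is at most the sum. *)

Lemma sing_val_ge0 (R : realType) (m n : nat) (X : 'M[R]_(m, n)) (i : nat) :
  0 <= sing_val X i.
Proof.
rewrite /sing_val; have [ilt|ige] := ltnP i (size (singular_values X)).
  have := mem_nth 0 ilt; rewrite mem_rev => /flattenP[_ /mapP[x _ ->]].
  by rewrite mem_nseq => /andP[_ /eqP ->]; exact: sqrtr_ge0.
(* Past the end of the list, [nth] returns its default value 0. *)
by rewrite nth_default.
Qed.

Lemma regularizer_ge0 (R : realType) (m n : nat) (rhat : R -> R)
    (X : 'M[R]_(m, n)) :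
  (forall x, 0 <= x -> 0 <= rhat x) -> 0 <= regularizer rhat X.
Proof. by move=> rhat_ge0; apply: sumr_ge0 => i _; exact/rhat_ge0/sing_val_ge0. Qed.

(** Passes from the extended-real hypothesis on $\inf f$ to a real bound. The point [u0] excludes
    the value [+oo], which is the infimum of an empty range. *)
Lemma ereal_inf_range_lbound (R : realType) (U : Type) (u0 : U) (f : U -> R) :
  (-oo < ereal_inf (range (fun x => (f x)%:E)))%E ->
  exists M, forall x, M <= f x.
Proof.
have le_f x : (ereal_inf (range (fun x => (f x)%:E)) <= (f x)%:E)%E.
  by apply: ereal_inf_lbound; exists x.
case: (ereal_inf _) le_f => [r||] // le_f _; last by have := le_f u0.
by exists r => x; rewrite -lee_fin.
Qed.

(** The minimum is below each of the [b - a] summands. The seed [x] can only lower it, so [x] is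
    arbitrary; if [b <= a], truncated subtraction makes both sides 0. *)
Lemma bigmin_nat_mul_le_sum (R : realDomainType) (x : R) (d : nat -> R)
    (a b : nat) :
  \big[Order.min/x]_(a <= t < b) d t * (b - a)%:R <= \sum_(a <= t < b) d t.
Proof.
rewrite mulr_natr -sumr_const_nat big_seq [leRHS]big_seq.
by apply: ler_sum => t t_in; exact: ge_bigmin_seq.
Qed.

Theorem corollary3p8 (R : realType) (m n : nat)
    (f : 'M[R]_(m, n) -> R) (rhat : R -> R) (lambda rho tau gamma c1 : R)
    (lambda_gt0 : 0 < lambda)
    (f_diff : forall X : 'M[R]_(m, n), differentiable (f : 'M[R]_(m, n) -> R^o) X)
    (grad_lip : forall X1 X2,
       fnorm (grad f X1 - grad f X2) <= rho * fnorm (X1 - X2))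
    (rho_le1 : rho <= 1)
    (f_inf : (-oo < ereal_inf (range (fun X => (f X)%:E)))%E)
    (f_coercive : forall A : R, exists B : R,
       forall X, B <= fnorm X -> A <= f X)
    (rhat_concave :
       convex_function (E := R^o) `[0, +oo[%classic (fun x : R => - rhat x))
    (rhat_nondecreasing : forall x y : R, 0 <= x -> x <= y -> rhat x <= rhat y)
    (rhat0 : rhat 0 = 0)
    (rho_lt_tau : rho < tau)
    (c1E : c1 = (tau - rho) / 4)
    (gamma_gt0 : 0 < gamma)
    (gamma_thr : forall s : R, 0 <= s <= gamma ->
       prox_argmin rhat (lambda / tau) s 0)
    (X : nat -> 'M[R]_(m, n)) (V : nat -> colmx R n)
    (run : fancl f rhat lambda tau gamma c1 X V)
    (T : nat) (T_ge1 : (1 <= T)%N) :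
  let F := objective f rhat lambda in
  \big[Order.min/fnorm (X 2%N - X 1%N) ^+ 2]_(1 <= t < T.+1)
      fnorm (X t.+1 - X t) ^+ 2
    <= (F (X 1%N) - inf (range F)) / (c1 * T%:R).
Proof.
set F := objective f rhat lambda; lazy zeta.
have c1_gt0 : 0 < c1 by rewrite c1E divr_gt0 // subr_gt0.
have [M le_Mf] := ereal_inf_range_lbound _ _ 0 _ f_inf.
have le_infF Y : inf (range F) <= F Y.
  (* The real-valued [inf] is a genuine lower bound only for a set that is bounded below, hence the
     witness [M]. *)
  apply: ge_inf; last by exists Y.
  exists M => _ [Z _ <-]; apply: le_trans (le_Mf Z) _.
  rewrite lerDl mulr_ge0 ?(ltW lambda_gt0) // regularizer_ge0 // => x x_ge0.
  by rewrite -rhat0; exact: rhat_nondecreasing.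
(* The right side is kept as a negated forward difference, the shape that [sumrN] and
   [telescope_sumr] expect. *)
have descent t : (1 <= t)%N ->
    c1 * fnorm (X t.+1 - X t) ^+ 2 <= - (F (X t.+1) - F (X t)).
  case: run => _ _ _ step /step[q [W [_ [p [Xs [Vs [_ _ _ decr [-> _]]]]]]]].
  by rewrite opprB lerBrDl -lerBrDr.
rewrite ler_pdivlMr ?mulr_gt0 ?ltr0n // mulrCA.
apply: (@le_trans _ _ (c1 * \sum_(1 <= t < T.+1) fnorm (X t.+1 - X t) ^+ 2)).
  (* [T] is rewritten as [T.+1 - 1], the number of indices in the range. *)
  by rewrite ler_pM2l // -[T in T%:R]subn0 -subSS bigmin_nat_mul_le_sum.
rewrite mulr_sumr.
apply: (@le_trans _ _ (\sum_(1 <= t < T.+1) - (F (X t.+1) - F (X t)))).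
  by apply: ler_sum_nat => t /andP[t_ge1 _]; exact: descent.
(* The sum collapses to [F (X 1) - F (X T.+1)], and the last value is at least [inf (range F)]. *)
by rewrite sumrN (telescope_sumr (F \o X)) // opprB lerD2l lerN2 le_infF.
Qed.
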